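(* For the circular control problem (control set $U_C$), the quantity $\langle J,\Lambda_1+\Lambda_R\rangle$ is conserved (constant in time) along every lifted optimal trajectory $(g,X,\Lambda_1,\Lambda_R)$.
   Context: For $A,B\in\mathfrak{sl}_2(\mathbb{R})$ write $\langle A,B\rangle=\mathrm{trace}(AB)$ and $[A,B]=AB-BA$; $J=\begin{pmatrix}0&-1\\ 1&0\end{pmatrix}$. For $u=(u_0,u_1,u_2)$ with $u_0+u_1+u_2=1$ let $$Z_u=\begin{pmatrix}\frac{u_1-u_2}{\sqrt3}&\frac{u_0-2u_1-2u_2}{3}\\ u_0&\frac{u_2-u_1}{\sqrt3}\end{pmatrix}\in\mathfrak{sl}_2(\mathbb{R}).$$ $U_C=\{u\in\mathbb{R}^3:\ u_0+u_1+u_2=1,\ u_0^2+u_1^2+u_2^2\le1\}$ is the circumscribing disk of the 2-simplex. The circular control problem is the free-terminal-time problem on $\mathrm{SL}_2(\mathbb{R})\times\mathfrak{sl}_2(\mathbb{R})$: $g'=gX$, $X'=[Z_u,X]/\langle Z_u,X\rangle$, $u(t)\in U_C$, minimizing $-\frac32\int_0^{t_f}\langle J,X\rangle\,dt$. Here $X$ is in the adjoint orbit of $J$ (i.e. $\det X=1$ and lower-left entry positive), and $\langle X,Z_u\rangle<0$ for the controls so the dynamics is defined. A lifted optimal trajectory is one given by the Pontryagin Maximum Principle: $(g,X,\Lambda_1,\Lambda_2)$ with costate variables $\Lambda_1,\Lambda_2\in\mathfrak{sl}_2(\mathbb{R})$ (identified with its dual by the trace form), $\Lambda_R:=[\Lambda_2,X]$,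 a constant $\lambda_{cost}\le0$, and a control $u^*(t)\in U_C$ such that (for almost every $t$), with $P=Z_{u^*}/\langle Z_{u^*},X\rangle$, $$g'=gX,\quad X'=[P,X],\quad \Lambda_1'=[\Lambda_1,X],$$ $$\Lambda_R'=[P,\Lambda_R]-\langle\Lambda_R,P\rangle[P,X]+\left[-\Lambda_1+\tfrac32\lambda_{cost}J,X\right],$$ and $u^*(t)$ maximizes over $u\in U_C$ the Hamiltonian $\mathcal{H}=\left\langle\Lambda_1-\frac32\lambda_{cost}J,X\right\rangle-\frac{\langle\Lambda_R,Z_u\rangle}{\langle X,Z_u\rangle}$, which vanishes identically along the trajectory; $(\lambda_{cost},\Lambda_1,\Lambda_R)$ is never zero. *)

(* Defs.v *)
(* MathComp / MathComp-Analysis, over an arbitrary R : realType. *)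
From HB Require Import structures.
From mathcomp Require Import all_boot all_order all_algebra.
From mathcomp Require Import all_classical all_reals all_analysis.

Set Implicit Arguments.
Unset Strict Implicit.
Unset Printing Implicit Defensive.

Import Order.TTheory GRing.Theory Num.Theory.
Import numFieldNormedType.Exports.

Local Open Scope classical_set_scope.
Local Open Scope ring_scope.

(* Absolute continuity of f on the compact interval [a, b]; two open intervals
   of the finite family I are allowed to share an endpoint. *)
Definition abs_continuous (R : realType) (V : normedModType R) (a b : R)
    (f : R -> V) : Prop :=
  forall e : R, 0 < e -> exists2 d : R, 0 < d &
    forall (n : nat) (I : 'I_n -> R * R),
      (forall i, a <= (I i).1 <= (I i).2 /\ (I i).2 <= b) ->
      trivIset [set: 'I_n] (fun i => `](I i).1, (I i).2[%classic) ->
      \sum_(i < n) ((I i).2 - (I i).1) < d ->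
      \sum_(i < n) `|f (I i).2 - f (I i).1| < e.

Definition mx2 (R : realType) (a b c d : R) : 'M[R]_2 :=
  \matrix_(i, j) nth 0 (nth [::] [:: [:: a; b]; [:: c; d]] i) j.

Definition sl2 (R : realType) : set 'M[R]_2 := [set A | \tr A = 0].

Definition SL2 (R : realType) : set 'M[R]_2 := [set g | \det g = 1].

Definition trform (R : realType) (A B : 'M[R]_2) : R := \tr (A *m B).

Definition lie (R : realType) (A B : 'M[R]_2) : 'M[R]_2 := A *m B - B *m A.

Definition Jmx (R : realType) : 'M[R]_2 := mx2 0 (-1) 1 0.

Definition adjoint_orbit (R : realType) (A : 'M[R]_2) : set 'M[R]_2 :=
  [set h *m A *m invmx h | h in @SL2 R].

Definition Zmx (R : realType) (u : 'rV[R]_3) : 'M[R]_2 :=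
  let u0 := u 0 0 in let u1 := u 0 1 in let u2 := u 0 2%:R in
  mx2 ((u1 - u2) / Num.sqrt 3) ((u0 - 2 * u1 - 2 * u2) / 3)
      u0                       ((u2 - u1) / Num.sqrt 3).

Definition UC (R : realType) : set 'rV[R]_3 :=
  [set u | \sum_i u 0 i = 1 /\ \sum_i u 0 i ^+ 2 <= 1].

Definition Pmx (R : realType) (X : 'M[R]_2) (u : 'rV[R]_3) : 'M[R]_2 :=
  (trform (Zmx u) X)^-1 *: Zmx u.

Definition hamiltonian (R : realType) (lcost : R) (X L1 LR : 'M[R]_2)
    (u : 'rV[R]_3) : R :=
  trform (L1 - (3 / 2 * lcost) *: Jmx R) X
  - trform LR (Zmx u) / trform X (Zmx u).

Definition LambdaR (R : realType) (L2 X : R -> 'M[R]_2) (t : R) : 'M[R]_2 :=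
  lie (L2 t) (X t).

(* [tf] is the (free) terminal time, so it is a parameter; trajectories are
   Caratheodory solutions: absolutely continuous on [0, tf], with the
   differential equations holding almost everywhere. *)
Record lifted_optimal_trajectory (R : realType) (tf lcost : R)
    (g X L1 L2 : R -> 'M[R]_2) (u : R -> 'rV[R]_3) : Prop :=
  LiftedOptimalTrajectory {
  lo_state : forall t, 0 <= t <= tf ->
    [/\ SL2 (g t), adjoint_orbit (Jmx R) (X t) & UC (u t)] ;
  lo_star : forall t, 0 <= t <= tf ->
    forall v, UC v -> trform (X t) (Zmx v) < 0 ;
  lo_costate : forall t, 0 <= t <= tf ->
    sl2 (L1 t) /\ sl2 (L2 t) ;
  lo_cost : lcost <= 0 ;
  (* L2 is determined by LambdaR only modulo multiples of X, and its evolution is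
     prescribed only through LambdaR: regularity is imposed on LambdaR. *)
  lo_ac : [/\ abs_continuous 0 tf g, abs_continuous 0 tf X,
    abs_continuous 0 tf L1 & abs_continuous 0 tf (LambdaR L2 X)] ;
  lo_ode : {ae lebesgue_measure, forall t : R, 0 < t < tf ->
    let P := Pmx (X t) (u t) in
    [/\ is_derive t 1 g (g t *m X t),
        is_derive t 1 X (lie P (X t)),
        is_derive t 1 L1 (lie (L1 t) (X t)) &
        is_derive t 1 (LambdaR L2 X)
          (lie P (LambdaR L2 X t)
           - trform (LambdaR L2 X t) P *: lie P (X t)
           + lie (- L1 t + (3 / 2 * lcost) *: Jmx R) (X t))]} ;
  lo_max : {ae lebesgue_measure, forall t : R, 0 < t < tf ->
    forall v, UC v ->
      hamiltonian lcost (X t) (L1 t) (LambdaR L2 X t) v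
      <= hamiltonian lcost (X t) (L1 t) (LambdaR L2 X t) (u t)} ;
  lo_vanish : {ae lebesgue_measure, forall t : R, 0 < t < tf ->
    hamiltonian lcost (X t) (L1 t) (LambdaR L2 X t) (u t) = 0} ;
  lo_nontrivial : forall t, 0 <= t <= tf ->
    ~ [/\ lcost = 0, L1 t = 0 & LambdaR L2 X t = 0]
}.

(* Main.v *)
Require Import Defs.
From HB Require Import structures.
From mathcomp Require Import all_boot all_order all_algebra.
From mathcomp Require Import all_classical all_reals all_analysis.
From mathcomp Require Import measurable_realfun.
From mathcomp Require Import ring lra.

Set Implicit Arguments.
Unset Strict Implicit.
Unset Printing Implicit Defensive.

Import Order.TTheory GRing.Theory Num.Theory.
Import numFieldNormedType.Exports.

Local Open Scope classical_set_scope.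
Local Open Scope ring_scope.

(** The conservation law is Noether's theorem for the rotations of the control
disk. The map [Zmx] turns the rotation of [UC] by the angle theta into
conjugation by the rotation of the plane by theta / 2, whose infinitesimal
generator is [lie J] / 2 (lemma [Zmx_rotate]). Hence a control that maximizes
the Hamiltonian over the disk is in particular a maximum along its orbit under
rotations, and the quotient of [trform LR (Zmx v)] by [trform X (Zmx v)] is
stationary in the direction [lie J (Zmx v)] (lemma [stationary_control]).

Put Q = <J, L1 + LR>. In Q' the contributions of L1 cancel, the cost term
drops out because <J, [J, X]> = <X, [J, J]> = 0, and by cyclicity of the trace
the rest is
   <LR, [J, Z]> / D - <LR, Z> <X, [J, Z]> / D^2,   with D = <X, Z>,
that is, up to a constant factor, the derivative just shown to vanish (lemma
[conserved_derivative]).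

So Q' = 0 almost everywhere. As Q is only known to be absolutely continuous,
its constancy requires the theorem that an absolutely continuous function with
almost everywhere zero derivative is constant
([abs_continuous_derive0_cst]). The exceptional null set is enclosed in an open
set U of small measure, and an induction along the interval splits the
increment of the function into steps around points of zero derivative, whose
total contribution is at most e times the length, and steps inside U, whose
total contribution is controlled by absolute continuity. *)

(** * Absolutely continuous functions with zero derivative *)

(** This form of induction on the points of [a, b] plays the role of Cousin's
lemma: a property that crosses every point within some gauge reaches [b],
because it holds at the supremum of the points that it reaches and cannot stop
there. *)
Lemma real_induction (R : realType) (a b : R) (S : set R) : a <= b -> S a ->
  (forall t, a <= t <= b -> exists2 d, 0 < d & forall x y,
     a <= x -> t - d < x -> x <= t -> t <= y -> y < t + d -> y <= b ->
     S x -> S y) ->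
  S b.
Proof.
move=> ab Sa step; pose E := [set x | a <= x <= b /\ S x].
have Ea : E a by split=> //; rewrite lexx.
have ubE : ubound E b by move=> x [/andP[]].
have supE : has_sup E by split; [exists a | exists b].
have aE : a <= sup E by apply: ub_le_sup => //; exists b.
have Eb : sup E <= b by apply: ge_sup => //; exists a.
have [|d d0 stepd] := step (sup E); first by rewrite aE.
have [x [/andP[ax xb] Sx] dx] := sup_adherent d0 supE.
have xE : x <= sup E by apply: ub_le_sup; [exists b|split=> //; rewrite ax].
have SE : S (sup E) by apply: (stepd x) => //; rewrite ltrDl.
have [<- //|Enb] := eqVneq (sup E) b.
have Eltb : sup E < b by rewrite lt_neqAle Enb.
pose y := Num.min b (sup E + d / 2).
have Ey : sup E < y by rewrite lt_min Eltb ltrDl divr_gt0.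
have yb : y <= b by rewrite ge_min lexx.
have Sy : S y.
  apply: (stepd (sup E)) => //; [by rewrite ltrBlDr ltrDl|exact: ltW|].
  by rewrite gt_min; apply/orP; right; rewrite ltrD2l; lra.
have : y <= sup E.
  by apply: ub_le_sup; [exists b|split=> //; rewrite yb (le_trans aE (ltW Ey))].
by rewrite leNgt Ey.
Qed.

Lemma negligible_open_cover (R : realType) (N : set R) (e : R) :
  (@lebesgue_measure R).-negligible N -> 0 < e ->
  exists U : set R,
    [/\ open U, N `<=` U & (lebesgue_measure U < e%:E)%E].
Proof.
move=> [M [mM M0 NM]] e0.
have Moo : (lebesgue_measure M < +oo)%E by rewrite M0 ltry.
have [U [oU MU Ue]] := lebesgue_regularity_outer mM Moo e0.
exists U; split=> //; first exact: subset_trans MU.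
have mU : measurable U by exact: open_measurable.
have := measureDI lebesgue_measure mU mM.
rewrite (_ : _ (U `&` M) = 0%E) ?adde0 => [->//|].
by apply/eqP; rewrite -measure_le0 -M0 le_measure ?inE//; exact: measurableI.
Qed.

(** The estimate at [t] is available on each side of [t], which is why the
interval has to contain [t]; it need not shrink symmetrically. *)
Lemma derive0_gauge (R : realType) (V : normedModType R) (f : R -> V)
    (t e : R) : 0 < e -> is_derive t 1 f 0 ->
  exists2 d, 0 < d & forall x y, t - d < x -> x <= t -> t <= y -> y < t + d ->
    `|f y - f x| <= e * (y - x).
Proof.
move=> e0 [df Df].
have : (fun h => h^-1 *: ((f \o shift t) (h *: (1 : R)) - f t)) @ 0^' --> (0 : V).
  by rewrite -Df; exact: df.
move=> /cvgr0_norm_le /(_ e e0).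
rewrite near_withinE => /nbhs_ballP[d /= d0 near0].
have near1 z : `|z - t| < d -> `|f z - f t| <= e * `|z - t|.
  move=> zd; have [->|zt] := eqVneq z t; first by rewrite !subrr !normr0 mulr0.
  have zt0 : z - t != 0 by rewrite subr_eq0.
  have := near0 (z - t); rewrite /ball /= sub0r normrN => /(_ zd zt0).
  rewrite normrZ normfV [_%:A]mulr1 subrK.
  by rewrite ler_pdivrMl ?normr_gt0// mulrC.
exists d => // x y tx xt ty yt.
have -> : f y - f x = (f y - f t) - (f x - f t) by rewrite opprB addrA subrK.
apply: le_trans (ler_normB _ _) _.
have -> : e * (y - x) = e * `|y - t| + e * `|x - t|.
  by rewrite ger0_norm ?subr_ge0// ler0_norm ?subr_le0//; ring.
apply: lerD; apply: near1.
  by rewrite ger0_norm ?subr_ge0//; lra.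
by rewrite ler0_norm ?subr_le0//; lra.
Qed.

(** The induction carries along the disjoint intervals collected inside [U],
and bounds their total length by the measure of the part of [U] already
traversed. This bound passes from [x] to [y] by additivity of the measure, and
at [b] it makes absolute continuity applicable. *)
Lemma abs_continuous_derive0_cst (R : realType) (V : normedModType R)
    (a b : R) (f : R -> V) : a <= b -> abs_continuous a b f ->
  {ae lebesgue_measure, forall t : R, a < t < b -> is_derive t 1 f 0} ->
  f b = f a.
Proof.
move=> ab ac /= aef.
(* Adding the endpoints to the null set disposes of one-sided derivatives. *)
pose N := ~` [set t | a < t < b -> is_derive t 1 f 0] `|` [set a] `|` [set b].
have negN : (@lebesgue_measure R).-negligible N.
  by apply: negligibleU; [apply: negligibleU => //|];
    apply/negligibleP => //; exact: lebesgue_measure_set1.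
have derf t : a <= t <= b -> ~ N t -> is_derive t 1 f 0.
  move=> /andP[ta tb] Nt; have [df|ndf] :=
      pselect (a < t < b -> is_derive t 1 f 0).
    apply: df; rewrite !lt_neqAle ta tb !andbT; apply/andP; split; apply/eqP => E.
      by apply: Nt; left; right; rewrite E.
    by apply: Nt; right; rewrite -E.
  by exfalso; apply: Nt; left; left.
suff small e : 0 < e -> `|f b - f a| <= e * (b - a + 1).
  apply/eqP; rewrite -subr_eq0 -normr_le0; apply/ler_addgt0Pl => e e0.
  rewrite addr0; have q0 : 0 < b - a + 1 by lra.
  have := small (e / (b - a + 1)); rewrite divr_gt0// mulfVK ?gt_eqF//.
  exact.
move=> e0; have [d d0 acd] := ac _ e0.
have [U [oU NU Ud]] := negligible_open_cover negN d0.
have mU : measurable U by exact: open_measurable.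
pose S x := exists n (I : 'I_n -> R * R), [/\
  forall i, a <= (I i).1 <= (I i).2 /\ (I i).2 <= x,
  trivIset [set: 'I_n] (fun i => `](I i).1, (I i).2[%classic),
  ((\sum_(i < n) ((I i).2 - (I i).1))%:E <= lebesgue_measure (U `&` `[a, x[))%E &
  `|f x - f a| <= e * (x - a) + \sum_(i < n) `|f (I i).2 - f (I i).1|].
have : S b.
  apply: (@real_induction _ a b) => //.
    exists 0, (fun=> (0, 0)); split=> [[]//| | |]; first by move=> [].
      by rewrite big_ord0 measure_ge0.
    by rewrite big_ord0 !subrr normr0 mulr0 addr0.
  (* Outside N the collected intervals are kept and the slope bound is used;
     inside N the interval `]x, y[ lies in U and is collected. *)
  move=> t tab; have [Nt|Nt] := pselect (N t); last first.
    have [r r0 near_t] := derive0_gauge e0 (derf _ tab Nt).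
    exists r => // x y ax tx xt ty yt yb [n [I [Iax trI leI fx]]].
    exists n, I; split=> //.
    - move=> i; have [? Ix] := Iax i; split=> //; lra.
    - apply: le_trans leI _; apply: le_measure; rewrite ?inE.
      + exact: measurableI.
      + exact: measurableI.
      + by apply: setIS; apply: subset_itvl; rewrite bnd_simp; lra.
    - have := near_t x y tx xt ty yt.
      have := ler_distD (f x) (f y) (f a).
      set s := \sum_(_ < _) _ in fx *.
      by move: `|_| `|f y - f x| `|f x - f a| fx => A B C; lra.
  have /nbhs_ballP[r /= r0 Ur] : nbhs t U.
    by apply: open_nbhs_nbhs; split; [|exact: NU].
  exists r => // x y ax tx xt ty yt yb [n [I [Iax trI leI fx]]].
  pose I' (i : 'I_n.+1) := if unlift ord_max i is Some j then I j else (x, y).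
  have I'last : I' ord_max = (x, y) by rewrite /I' unlift_none.
  have I'wid (i : 'I_n) : I' (widen_ord (leqnSn n) i) = I i.
    have -> : widen_ord (leqnSn n) i = lift ord_max i.
      by apply/val_inj => /=; rewrite /bump leqNgt ltn_ord.
    by rewrite /I' liftK.
  exists n.+1, I'; split.
  - move=> i; rewrite /I'; case: unliftP => [j _|_] /=; last first.
      by rewrite ax lexx; split=> //; lra.
    by have [? ?] := Iax j; split=> //; lra.
  - move=> i j _ _; rewrite /I'.
    case: unliftP => [i' ->|->]; case: unliftP => [j' ->|->] //=.
    + by move=> /trI ->.
    + move=> [z [/=]]; rewrite !in_itv/= => /andP[_ zi] /andP[xz _].
      by have [_ ?] := Iax i'; exfalso; lra.
    + move=> [z [/=]]; rewrite !in_itv/= => /andP[xz _] /andP[_ zi].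
      by have [_ ?] := Iax j'; exfalso; lra.
  - rewrite big_ord_recr /= I'last /=.
    under eq_bigr do rewrite I'wid.
    have -> : U `&` `[a, y[ = (U `&` `[a, x[) `|` `[x, y[.
      rewrite (@itv_bndbnd_setU _ _ (BLeft a) (BLeft x) (BLeft y)) ?bnd_simp//;
        last lra.
      rewrite setIUr; congr (_ `|` _); apply: setIidr => z /=.
      rewrite in_itv/= => /andP[xz zy]; apply: Ur => /=.
      by rewrite /ball /= ltr_norml; apply/andP; split; lra.
    rewrite measureU//; last 2 first.
    + exact: measurableI.
    + apply/seteqP; split=> // z /= [[_]]; rewrite !in_itv/=.
      by move=> /andP[_ zx] /andP[xz _]; lra.
    rewrite EFinD leeD//.
    rewrite [leRHS](lebesgue_measure_itv `[x, y[) /= lte_fin.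
    by case: ltP => yx; rewrite -?EFinD lee_fin //; lra.
  - rewrite big_ord_recr /= I'last /=.
    under eq_bigr do rewrite I'wid.
    have := ler_distD (f x) (f y) (f a).
    have : 0 <= e * (y - x) by rewrite mulr_ge0//; lra.
    set s := \sum_(_ < _) _ in fx *.
    by move: `|_| `|f y - f x| `|f x - f a| fx => A B C; lra.
move=> [n [I [Iab trI leI fb]]].
have := acd n I Iab trI; rewrite -lte_fin => small.
have mUd : (lebesgue_measure (U `&` `[a, b[) < d%:E)%E.
  apply: le_lt_trans Ud; apply: le_measure; rewrite ?inE//.
  exact: measurableI.
have := small (le_lt_trans leI mUd).
by move: fb; set s := \sum_(_ < _) _; set A := `|_|; lra.
Qed.

Lemma abs_continuousD (R : realType) (V : normedModType R) (a b : R)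
    (f h : R -> V) : abs_continuous a b f -> abs_continuous a b h ->
  abs_continuous a b (fun x => f x + h x).
Proof.
move=> acf ach e e0; have e2 : 0 < e / 2 by rewrite divr_gt0.
have [d d0 fd] := acf _ e2; have [d' d'0 hd] := ach _ e2.
exists (Num.min d d'); first by rewrite lt_min d0.
move=> n I Iab trI; rewrite lt_min => /andP[sd sd'].
rewrite [ltRHS](splitr e).
apply: le_lt_trans (ltrD (fd n I Iab trI sd) (hd n I Iab trI sd')).
rewrite -big_split; apply: ler_sum => i _ /=.
by rewrite opprD addrACA ler_normD.
Qed.

Lemma abs_continuous_lipschitz (R : realType) (V W : normedModType R)
    (a b k : R) (phi : V -> W) (f : R -> V) :
  (forall x y, `|phi x - phi y| <= k * `|x - y|) ->
  abs_continuous a b f -> abs_continuous a b (phi \o f).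
Proof.
move=> phik acf e e0; pose K := Num.max 1 k.
have K0 : 0 < K by rewrite lt_max ltr01.
have [|d d0 fd] := acf (e / K); first by rewrite divr_gt0.
exists d => // n I Iab trI /(fd n I Iab trI); rewrite ltr_pdivlMr// => lte.
apply: le_lt_trans lte; rewrite mulr_suml; apply: ler_sum => i _ /=.
rewrite mulrC; apply: le_trans (phik _ _) _.
by rewrite ler_wpM2r// le_max lexx orbT.
Qed.

Lemma abs_continuous_sub (R : realType) (V : normedModType R)
    (a b c d : R) (f : R -> V) : a <= c -> d <= b ->
  abs_continuous a b f -> abs_continuous c d f.
Proof.
move=> ac db acf e e0; have [r r0 fr] := acf e e0.
exists r => // n I Icd; apply: fr => i.
by have [/andP[ci ->] id] := Icd i; rewrite (le_trans ac ci) (le_trans id db).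
Qed.

(** * The rotation of the control disk *)

Lemma sum2E (R : realType) (F : 'I_2 -> R) : \sum_i F i = F 0 + F 1.
Proof.
rewrite !big_ord_recl big_ord0 addr0.
by congr (F _ + F _); apply/val_inj.
Qed.

Lemma trformE (R : realType) (A B : 'M[R]_2) :
  trform A B = A 0 0 * B 0 0 + A 0 1 * B 1 0 + A 1 0 * B 0 1 + A 1 1 * B 1 1.
Proof. by rewrite /trform /mxtrace !sum2E !mxE !sum2E !addrA. Qed.

Lemma matrix2P (R : realType) (A B : 'M[R]_2) :
  A 0 0 = B 0 0 -> A 0 1 = B 0 1 -> A 1 0 = B 1 0 -> A 1 1 = B 1 1 -> A = B.
Proof.
move=> e00 e01 e10 e11; apply/matrixP => i j.
have ord2 (k : 'I_2) : k = 0 \/ k = 1.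
  by case: k => [[|[|k]] // kP]; [left|right]; exact/val_inj.
by case: (ord2 i) => ->; case: (ord2 j) => ->.
Qed.

Lemma trformDr (R : realType) (A B C : 'M[R]_2) :
  trform A (B + C) = trform A B + trform A C.
Proof. by rewrite /trform mulmxDr mxtraceD. Qed.

Lemma trformZr (R : realType) (k : R) (A B : 'M[R]_2) :
  trform A (k *: B) = k * trform A B.
Proof. by rewrite /trform -scalemxAr mxtraceZ. Qed.

Lemma trformC (R : realType) (A B : 'M[R]_2) : trform A B = trform B A.
Proof. exact: mxtrace_mulC. Qed.

Lemma trform_lie_cyclic (R : realType) (A B C : 'M[R]_2) :
  trform A (lie B C) = trform C (lie A B).
Proof.
rewrite /trform /lie !mulmxBr !raddfB /= !mulmxA.
rewrite (mxtrace_mulC (A *m B) C) (mxtrace_mulC (A *m C) B) !mulmxA.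
by rewrite (mxtrace_mulC (B *m A) C) !mulmxA.
Qed.

(** The rotation, by the angle of cosine [c] and sine [s], about the barycentre
(1/3, 1/3, 1/3) of the simplex. With indices modulo 3, the vector
(v_(i+1) - v_(i+2)) / sqrt 3 is [v] minus the barycentre turned by a right
angle in the plane where the coordinates have sum zero. *)
Definition rotate_control (R : realType) (c s : R) (v : 'rV[R]_3) : 'rV[R]_3 :=
  \row_i (c * v 0 i + (1 - c) / 3
          + s * ((v 0 (i + 1) - v 0 (i + 2)) / Num.sqrt 3)).

Lemma sum3E (R : realType) (F : 'I_3 -> R) :
  \sum_i F i = F 0 + F 1 + F 2.
Proof.
rewrite !big_ord_recl big_ord0 addr0 addrA.
by congr (F _ + F _ + F _); apply/val_inj.
Qed.

Lemma invsqrt3_sqr (R : realType) : (Num.sqrt 3)^-1 ^+ 2 = 3^-1 :> R.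
Proof. by rewrite exprVn sqr_sqrtr. Qed.

(** A rotation about the barycentre preserves the plane and the distance to the
barycentre, hence the sum of the squares of the coordinates. *)
Lemma rotate_control_UC (R : realType) (c s : R) (v : 'rV[R]_3) :
  c ^+ 2 + s ^+ 2 = 1 -> UC v -> UC (rotate_control c s v).
Proof.
move=> cs [].
rewrite /UC /= !sum3E !mxE.
have -> : 1 + 1 = 2 :> 'I_3 by exact/val_inj.
have -> : 1 + 2 = 0 :> 'I_3 by exact/val_inj.
have -> : 2 + 1 = 0 :> 'I_3 by exact/val_inj.
have -> : 2 + 2 = 1 :> 'I_3 by exact/val_inj.
rewrite !add0r => sum1 le1.
have := invsqrt3_sqr R; set r := (Num.sqrt 3)^-1; clearbody r.
move: (v 0 0) (v 0 1) (v 0 2) sum1 le1 => x y z sum1 le1 r3.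
have zE : z = 1 - x - y by rewrite -sum1; ring.
have sE : s ^+ 2 = 1 - c ^+ 2 by rewrite -cs; ring.
have r3' : r ^+ 2 * 3 = 1 by rewrite r3 mulVf// pnatr_eq0.
split; first by rewrite zE; field.
apply: le_trans le1; rewrite le_eqVlt; apply/orP; left; apply/eqP; rewrite zE.
rewrite [LHS](_ : _ = (c ^+ 2 + (r ^+ 2 * 3) * s ^+ 2)
   * (x ^+ 2 + y ^+ 2 + (1 - x - y) ^+ 2 - 3^-1) + 3^-1); last first.
  by field.
by rewrite r3' sE; field.
Qed.

(** [Zmx] sends the barycentre to J / 3 and the disk to a disk around J / 3
in the plane J / 3 + (orthogonal complement of J), on which [lie J] / 2 is the
rotation by a right angle. *)
Lemma Zmx_rotate (R : realType) (c s : R) (v : 'rV[R]_3) : UC v ->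
  Zmx (rotate_control c s v) =
  c *: Zmx v + ((1 - c) / 3) *: Jmx R + (s / 2) *: lie (Jmx R) (Zmx v).
Proof.
move=> [+ _]; rewrite sum3E => sum1.
have i0 : 1 + 1 = 2 :> 'I_3 by exact/val_inj.
have i1 : 1 + 2 = 0 :> 'I_3 by exact/val_inj.
have i2 : 2 + 1 = 0 :> 'I_3 by exact/val_inj.
have i3 : 2 + 2 = 1 :> 'I_3 by exact/val_inj.
have := invsqrt3_sqr R; set r := (Num.sqrt 3)^-1 => r3.
apply: matrix2P; rewrite !mxE /= !sum2E !mxE /= ?i0 ?i1 ?i2 ?i3 ?add0r -/r.
all: have -> : v 0 0 = 1 - v 0 1 - v 0 2 by rewrite -sum1; ring.
all: clearbody r; move: (v 0 1) (v 0 2) => y z.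
(* The off-diagonal entries are linear in 1 / sqrt 3 on both sides; in the
   diagonal ones it occurs squared and has to be eliminated first. *)
- rewrite [LHS](_ : _ = c * ((y - z) * r) + r ^+ 2 * (s * (3 * y + 3 * z - 2))).
    by rewrite r3; field.
  by ring.
- by field.
- by field.
- rewrite [LHS](_ : _ = c * ((z - y) * r) - r ^+ 2 * (s * (3 * y + 3 * z - 2))).
    by rewrite r3; field.
  by ring.
Qed.

(** First-order condition on the unit circle: near c = 1 the right-hand side
is of second order in [s]. The rational parametrization of the circle makes
this algebraic. *)
Lemma linear_dominated_eq0 (R : realType) (a b : R) :
  (forall c s, c ^+ 2 + s ^+ 2 = 1 -> s * b <= (1 - c) * a) -> b = 0.
Proof.
move=> ab.
have xab x : x * b <= x ^+ 2 * a.
  have x1 : 0 < 1 + x ^+ 2 by rewrite ltr_wpDr ?sqr_ge0.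
  have := ab ((1 - x ^+ 2) / (1 + x ^+ 2)) (2 * x / (1 + x ^+ 2)).
  have -> : 1 - (1 - x ^+ 2) / (1 + x ^+ 2) = 2 * x ^+ 2 / (1 + x ^+ 2).
    by field; rewrite gt_eqF.
  have cs1 : ((1 - x ^+ 2) / (1 + x ^+ 2)) ^+ 2 + (2 * x / (1 + x ^+ 2)) ^+ 2 = 1.
    by field; rewrite gt_eqF.
  move=> /(_ cs1); rewrite (_ : _ * b = x * b * (2 / (1 + x ^+ 2))); last by ring.
  rewrite [leRHS](_ : _ = x ^+ 2 * a * (2 / (1 + x ^+ 2))); last by ring.
  by rewrite ler_pM2r// divr_gt0.
(* At x = b / q the inequality reads b^2 (q - a) / q^2 <= 0, and q is chosen
   so that q and q - a are positive. *)
pose q := 1 + a ^+ 2.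
have q0 : 0 < q by rewrite ltr_wpDr ?sqr_ge0.
have qa : 0 < q - a by rewrite /q; nra.
have := xab (b / q); rewrite -subr_ge0.
rewrite (_ : _ - _ = - (b ^+ 2 * ((q - a) / q ^+ 2))); last first.
  by field; rewrite gt_eqF.
rewrite oppr_ge0 pmulr_lle0 ?divr_gt0 ?exprn_gt0// => b2.
by apply/eqP; rewrite -sqrf_eq0 eq_le b2 sqr_ge0.
Qed.

(** * Stationarity of the Hamiltonian and the conserved quantity *)

(** Only the rotates of [v] are compared with [v]. By [Zmx_rotate] the numerator
and the denominator of the Hamiltonian are affine in the cosine and sine, so
after clearing the negative denominators the maximum condition has the form
required by [linear_dominated_eq0]. *)
Lemma stationary_control (R : realType) (lcost : R) (X L1 LR : 'M[R]_2)
    (v : 'rV[R]_3) : UC v ->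
  (forall w, UC w -> trform X (Zmx w) < 0) ->
  (forall w, UC w ->
     hamiltonian lcost X L1 LR w <= hamiltonian lcost X L1 LR v) ->
  trform LR (lie (Jmx R) (Zmx v)) * trform X (Zmx v)
  = trform LR (Zmx v) * trform X (lie (Jmx R) (Zmx v)).
Proof.
move=> Uv Xneg vmax; apply/esym/eqP; rewrite -subr_eq0; apply/eqP.
set n := trform LR (lie _ _); set d := trform X (lie _ _).
set N := trform LR (Zmx v); set D := trform X (Zmx v).
pose NJ := trform LR (Jmx R); pose DJ := trform X (Jmx R).
apply: (@linear_dominated_eq0 _ (2 / 3 * (NJ * D - N * DJ))) => c s cs.
have Uw := rotate_control_UC cs Uv.
have := vmax _ Uw; rewrite /hamiltonian lerD2l lerN2.
have := Xneg _ Uw; have := Xneg _ Uv.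
rewrite (Zmx_rotate c s Uv) !trformDr !trformZr -/N -/D -/n -/d -/NJ -/DJ.
set N' := c * N + _ + _; set D' := c * D + _ + _ => D0 D'0.
rewrite ler_ndivlMr// mulrAC ler_ndivlMr// -subr_ge0 => le0.
rewrite -subr_ge0 (_ : _ - _ = 2 * (N' * D - N * D')) ?mulr_ge0//.
by rewrite /N' /D'; field.
Qed.

(** The argument of [trform (Jmx R)] is the derivative of L1 + LR prescribed by
the costate equations, with [k] standing for the cost multiplier. *)
Lemma conserved_derivative (R : realType) (k : R) (X L1 LR : 'M[R]_2)
    (v : 'rV[R]_3) :
  trform X (Zmx v) != 0 ->
  trform LR (lie (Jmx R) (Zmx v)) * trform X (Zmx v)
  = trform LR (Zmx v) * trform X (lie (Jmx R) (Zmx v)) ->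
  let P := Pmx X v in
  trform (Jmx R) (lie L1 X + (lie P LR - trform LR P *: lie P X
    + lie (- L1 + k *: Jmx R) X)) = 0.
Proof.
move=> D0 crit P.
have -> : lie L1 X + (lie P LR - trform LR P *: lie P X
    + lie (- L1 + k *: Jmx R) X)
  = lie P LR - trform LR P *: lie P X + k *: lie (Jmx R) X.
  move: (lie P LR - _) (Jmx R) => M J.
  rewrite /lie mulmxDl mulmxDr mulNmx mulmxN -scalemxAl -scalemxAr.
  by apply/matrixP => i j; rewrite !mxE; ring.
rewrite trformDr -scaleNr trformDr !trformZr.
rewrite 3!(trform_lie_cyclic (Jmx R)).
have -> : lie (Jmx R) (Jmx R) = 0 by rewrite /lie subrr.
have -> : lie (Jmx R) P = (trform X (Zmx v))^-1 *: lie (Jmx R) (Zmx v).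
  by rewrite /P /Pmx (trformC _ X) /lie -scalemxAl -scalemxAr scalerBr.
rewrite /trform mulmx0 mxtrace0 -!/(trform _ _) mulr0 addr0 !trformZr.
rewrite (trformC _ X).
set n := trform LR (lie _ _) in crit *; set d := trform X (lie _ _) in crit *.
set N := trform LR _ in crit *; set D := trform X _ in crit D0 *.
rewrite (_ : _ + _ = (n * D - N * d) / D ^+ 2); last by field.
by rewrite crit subrr mul0r.
Qed.

Lemma trformJE (R : realType) (M : 'M[R]_2) : trform (Jmx R) M = M 0 1 - M 1 0.
Proof. by rewrite trformE !mxE /=; ring. Qed.

Lemma trformJ_lipschitz (R : realType) (M M' : 'M[R]_2) :
  `|trform (Jmx R) M - trform (Jmx R) M'| <= 2 * `|M - M'|.
Proof.
rewrite (_ : _ - _ = (M - M') 0 1 - (M - M') 1 0); last first.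
  by rewrite !trformJE !mxE; ring.
apply: le_trans (ler_normB _ _) _; rewrite mulr_natl mulr2n.
have entry i j : `|(M - M') i j| <= `|M - M'|.
  by rewrite [leRHS]mx_normrE; apply: (le_bigmax _ _ (i, j)).
exact: lerD.
Qed.

Lemma is_derive_trformJ (R : realType) (F : R -> 'M[R]_2) (t : R)
    (dF : 'M[R]_2) :
  is_derive t 1 F dF ->
  is_derive t 1 (fun x => trform (Jmx R) (F x)) (trform (Jmx R) dF).
Proof.
move=> [dvF eF].
have coord i j : is_derive t 1 (fun x => F x i j) (dF i j).
  have /derivable_mxP dij := dvF; apply: DeriveDef; first exact: dij.
  by rewrite -eF derive_mx// mxE.
have -> : (fun x => trform (Jmx R) (F x))
  = (fun x => F x 0 1) - (fun x => F x 1 0).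
  by apply/funext => x; rewrite trformJE.
by rewrite trformJE; apply: is_deriveB.
Qed.

Theorem theorem2p4p6 (R : realType) (tf lcost : R)
    (g X L1 L2 : R -> 'M[R]_2) (u : R -> 'rV[R]_3)
    (htf : 0 < tf)
    (hlift : lifted_optimal_trajectory tf lcost g X L1 L2 u) :
  forall s t : R, 0 <= s <= tf -> 0 <= t <= tf ->
    trform (Jmx R) (L1 s + LambdaR L2 X s)
    = trform (Jmx R) (L1 t + LambdaR L2 X t).
Proof.
case: hlift => st star _ _ [_ _ acL1 acLR] ode hmax _ _.
set Q := fun t => trform (Jmx R) (L1 t + LambdaR L2 X t).
suff Q0 t : 0 <= t <= tf -> Q t = Q 0.
  by move=> s t s0 t0; rewrite -/(Q s) -/(Q t) !Q0.
move=> /andP[t0 ttf].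
apply: abs_continuous_derive0_cst => //.
  apply: (abs_continuous_sub (lexx 0) ttf).
  apply: abs_continuous_lipschitz (abs_continuousD acL1 acLR) => M M'.
  exact: trformJ_lipschitz.
move: ode hmax.
apply: filterS2; first exact: (ae_filter_ringOfSetsType lebesgue_measure).
move=> r ode hmax /andP[r0 rt].
have rtf : 0 < r < tf by rewrite r0 (lt_le_trans rt).
have rtf' : 0 <= r <= tf by move: rtf => /andP[/ltW -> /ltW ->].
have [_ _ dL1 dLR] := ode rtf.
have [_ _ Ur] := st _ rtf'.
have Xneg := star _ rtf'.
have crit := stationary_control Ur Xneg (hmax rtf).
rewrite -(conserved_derivative (3 / 2 * lcost) (L1 r) _ crit) ?lt_eqF ?Xneg//.
exact: is_derive_trformJ.
Qed.
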